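(* Let $n\ge 2$, let $G\subsetneq\mathbb{R}^n$ be a domain and let $f:G\to fG\subsetneq\mathbb{R}^n$ be a sense-preserving homeomorphism satisfying the $L$-bilipschitz condition with respect to the triangular ratio metric, i.e. $$s_G(x,y)/L\leq s_{fG}(f(x),f(y))\leq L\,s_G(x,y)$$ holds for all $x,y\in G$, where $L\ge1$. Then $f$ is quasiconformal with linear dilatation $H(f)\leq L^2$.
   Context: For a domain $G\subsetneq\mathbb{R}^n$ and $x,y\in G$, the triangular ratio metric is $s_G(x,y)=\sup_{z\in\partial G}\frac{|x-y|}{|x-z|+|z-y|}$. The linear dilatation of $f$ at $z\in G$ is $H(f,z)=\limsup_{|x-z|=|y-z|=r\to0^+}\frac{|f(x)-f(z)|}{|f(y)-f(z)|}$, and $H(f)\le C$ means $H(f,z)\le C$ for all $z\in G$. *)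

(* Defs.v *)
From HB Require Import structures.
From mathcomp Require Import all_boot all_order all_algebra.
From mathcomp Require Import all_classical all_reals all_analysis.

Set Implicit Arguments.
Unset Strict Implicit.
Unset Printing Implicit Defensive.

Import Order.TTheory GRing.Theory Num.Theory.
Import numFieldNormedType.Exports.

Local Open Scope classical_set_scope.
Local Open Scope ring_scope.

(* The library norm on 'rV[R]_n is the sup norm; only its topology (and its
   differential calculus) is used below, all distances are Euclidean. *)
Definition enorm (R : realType) (n : nat) (x : 'rV[R]_n) : R :=
  Num.sqrt (\sum_(i < n) x ord0 i ^+ 2).

Definition boundary (T : topologicalType) (A : set T) : set T :=
  closure A `\` interior A.

Definition domain (R : realType) (n : nat) (G : set 'rV[R]_n) : Prop :=
  [/\ open G, connected G & G !=set0].

(* The quotients are bounded by 1, and the boundary is nonempty when A is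
   nonempty and A <> setT, so the real-valued [sup] is the true supremum. *)
Definition triangular_ratio (R : realType) (n : nat) (A : set 'rV[R]_n)
    (x y : 'rV[R]_n) : R :=
  sup [set enorm (x - y) / (enorm (x - z) + enorm (z - y))
      | z in boundary A].

(* Maps G -> R^n are total functions of which only the values on G matter. *)
Definition homeo_on (R : realType) (n : nat) (G : set 'rV[R]_n)
    (f : 'rV[R]_n -> 'rV[R]_n) : Prop :=
  {within G, continuous f} /\
  exists2 g : 'rV[R]_n -> 'rV[R]_n,
    {within f @` G, continuous g} & forall x, G x -> g (f x) = x.

Definition C1_on (R : realType) (n : nat) (D : set 'rV[R]_n)
    (g : 'rV[R]_n -> 'rV[R]_n) : Prop :=
  forall x, D x -> differentiable g x /\ {for x, continuous (jacobian g)}.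

(* The Brouwer degree mu(y, f, D) is d, for D bounded open, f continuous on the
   closure of D, and y outside the image of the boundary: d is the sum of the
   signs of the Jacobian determinants over the preimages of y under a C^1 map g
   closer to f than the distance from y to that image and having y as a regular
   value.  Such g exist and all give the same d.  (The set of preimages is
   finite, so the finitely supported sum is the actual one.) *)
Definition brouwer_degree (R : realType) (n : nat)
    (f : 'rV[R]_n -> 'rV[R]_n) (D : set 'rV[R]_n) (y : 'rV[R]_n)
    (d : int) : Prop :=
  exists g : 'rV[R]_n -> 'rV[R]_n,
    [/\ {within closure D, continuous g},
        C1_on D g,
        forall x w, closure D x -> boundary D w ->
          enorm (g x - f x) < enorm (y - f w),
        forall x, D x -> g x = y -> \det (jacobian g x) != 0
      & d = \sum_(x \in D `&` [set x | g x = y]) sgz (\det (jacobian g x))].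

Definition sense_preserving (R : realType) (n : nat) (G : set 'rV[R]_n)
    (f : 'rV[R]_n -> 'rV[R]_n) : Prop :=
  forall (D : set 'rV[R]_n) (y : 'rV[R]_n),
    domain D -> compact (closure D) -> closure D `<=` G ->
    (f @` D `\` f @` boundary D) y ->
    exists2 d : int, brouwer_degree f D y d & 0 < d.

Definition dilatation_at (R : realType) (n : nat) (G : set 'rV[R]_n)
    (f : 'rV[R]_n -> 'rV[R]_n) (z : 'rV[R]_n) (r : R) : \bar R :=
  ereal_sup [set e | exists x y : 'rV[R]_n,
    [/\ G x, G y, enorm (x - z) = r, enorm (y - z) = r &
        e = (enorm (f x - f z) / enorm (f y - f z))%:E]].

Definition linear_dilatation (R : realType) (n : nat) (G : set 'rV[R]_n)
    (f : 'rV[R]_n -> 'rV[R]_n) (z : 'rV[R]_n) : \bar R :=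
  limf_esup (dilatation_at G f z) (0^'+).

(* Metric definition: the linear dilatation is bounded. *)
Definition quasiconformal (R : realType) (n : nat) (G : set 'rV[R]_n)
    (f : 'rV[R]_n -> 'rV[R]_n) : Prop :=
  [/\ domain G, domain (f @` G), homeo_on G f &
      exists C : R, forall z, G z -> (linear_dilatation G f z <= C%:E)%E].

(* Main.v *)
(* For [z] in [G] at distance [d] from the boundary and [|x - z| = r < 2d], the
   triangle inequality gives [r / (2d + r) <= s_G(x, z) <= r / (2d - r)]; the
   same holds at [f z], with [d'] and [|f x - f z|].  Combining these with the
   bilipschitz inequalities for two points at distance [r] from [z], the ratio
   [|f x - f z| / |f y - f z|] is at most [L^2] times a factor tending to 1
   as [r] tends to 0. *)
Require Import Defs.
From HB Require Import structures.
From mathcomp Require Import all_boot all_order all_algebra.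
From mathcomp Require Import all_classical all_reals all_analysis.
From mathcomp Require Import ring lra.

Import Order.TTheory GRing.Theory Num.Theory.
Import numFieldNormedType.Exports.

Local Open Scope classical_set_scope.
Local Open Scope ring_scope.

(** * Euclidean norm and topological preliminaries *)

Lemma enorm_ge0 (R : realType) (n : nat) (x : 'rV[R]_n) : 0 <= enorm x.
Proof. exact: sqrtr_ge0. Qed.

Lemma sqr_enorm (R : realType) (n : nat) (x : 'rV[R]_n) :
  enorm x ^+ 2 = \sum_(i < n) x ord0 i ^+ 2.
Proof. by rewrite sqr_sqrtr// sumr_ge0// => i _; exact: sqr_ge0. Qed.

Lemma enormN (R : realType) (n : nat) (x : 'rV[R]_n) : enorm (- x) = enorm x.
Proof. by congr Num.sqrt; apply: eq_bigr => i _; rewrite mxE sqrrN. Qed.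

Lemma enormBC (R : realType) (n : nat) (x y : 'rV[R]_n) :
  enorm (x - y) = enorm (y - x).
Proof. by rewrite -enormN opprB. Qed.

Lemma normr_le_enorm (R : realType) (n : nat) (x : 'rV[R]_n) : `|x| <= enorm x.
Proof.
rewrite -[leLHS]/(mx_norm x) mx_normrE.
apply/bigmax_leP; split=> [|[i j] _ /=]; first exact: enorm_ge0.
rewrite (ord1 i) -ler_sqr ?nnegrE ?enorm_ge0// real_normK ?num_real//.
by rewrite sqr_enorm (bigD1 j)//= lerDl sumr_ge0// => k _; exact: sqr_ge0.
Qed.

Lemma enorm_le_normr (R : realType) (n : nat) (x : 'rV[R]_n) :
  enorm x <= n%:R * `|x|.
Proof.
have coord_le i : `|x ord0 i| <= `|x|.
  by rewrite -[leRHS]/(mx_norm x) mx_normrE; exact: (le_bigmax _ _ (ord0, i)).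
rewrite -ler_sqr ?nnegrE ?enorm_ge0 ?mulr_ge0// sqr_enorm exprMn.
apply: (@le_trans _ _ (\sum_(i < n) `|x| ^+ 2)).
  apply: ler_sum => i _.
  by rewrite -[leLHS]real_normK ?num_real// ler_sqr ?nnegrE.
rewrite sumr_const card_ord -[leLHS]mulr_natl ler_wpM2r ?sqr_ge0//.
by case: n {x coord_le} => [|n]; rewrite ?expr0n// ler_eXnr// ler1n.
Qed.

Lemma enorm_eq0 (R : realType) (n : nat) (x : 'rV[R]_n) : enorm x = 0 -> x = 0.
Proof.
move=> x0; apply/eqP; rewrite -normr_eq0 eq_le normr_ge0 andbT -x0.
exact: normr_le_enorm.
Qed.

Lemma enorm0 (R : realType) (n : nat) : enorm (0 : 'rV[R]_n) = 0.
Proof.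
by apply/eqP; rewrite eq_le enorm_ge0 (le_trans (enorm_le_normr _ _ _))// normr0 mulr0.
Qed.

(* Expanding [sum_i (|y| x_i - |x| y_i)^2 >= 0] and dividing by [2 |x| |y|]. *)
Lemma cauchy_schwarz (R : realType) (n : nat) (x y : 'rV[R]_n) :
  \sum_(i < n) x ord0 i * y ord0 i <= enorm x * enorm y.
Proof.
have [/enorm_eq0 ->|x0] := eqVneq (enorm x) 0.
  by rewrite big1 ?mulr_ge0 ?enorm_ge0// => i _; rewrite mxE mul0r.
have [/enorm_eq0 ->|y0] := eqVneq (enorm y) 0.
  by rewrite big1 ?mulr_ge0 ?enorm_ge0// => i _; rewrite mxE mulr0.
have xy0 : 0 < enorm x * enorm y by rewrite mulr_gt0 ?lt0r ?x0 ?y0 ?enorm_ge0.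
rewrite -(ler_pM2l xy0).
have : 0 <= \sum_(i < n) (enorm y * x ord0 i - enorm x * y ord0 i) ^+ 2.
  by apply: sumr_ge0 => i _; exact: sqr_ge0.
have -> : \sum_(i < n) (enorm y * x ord0 i - enorm x * y ord0 i) ^+ 2 =
    enorm y ^+ 2 * (\sum_(i < n) x ord0 i ^+ 2) +
    enorm x ^+ 2 * (\sum_(i < n) y ord0 i ^+ 2) -
    2 * (enorm x * enorm y) * \sum_(i < n) x ord0 i * y ord0 i.
  rewrite !mulr_sumr -big_split -sumrB; apply: eq_bigr => i _ /=; ring.
by rewrite -!sqr_enorm; nra.
Qed.

Lemma enormD (R : realType) (n : nat) (x y : 'rV[R]_n) :
  enorm (x + y) <= enorm x + enorm y.
Proof.
rewrite -ler_sqr ?nnegrE ?addr_ge0 ?enorm_ge0// sqr_enorm sqrrD !sqr_enorm.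
under eq_bigr => i _ do rewrite mxE sqrrD.
by rewrite !big_split/= lerD2r lerD2l lerD ?cauchy_schwarz.
Qed.

Lemma enormB_triangle (R : realType) (n : nat) (y x z : 'rV[R]_n) :
  enorm (x - z) <= enorm (x - y) + enorm (y - z).
Proof. by rewrite -[x - z](subrKA y) enormD. Qed.

Lemma open_enorm_ball (R : realType) (n : nat) (A : set 'rV[R]_n)
    (z : 'rV[R]_n) :
  nbhs z A -> exists2 e : R, 0 < e & forall x, enorm (x - z) < e -> A x.
Proof.
move=> /nbhs_ballP[e /= e0 eA]; exists e => // x xz; apply: eA.
rewrite -ball_normE /ball_/= distrC.
exact: le_lt_trans (normr_le_enorm _ _ _) xz.
Qed.

Lemma continuous_enorm (R : realType) (n : nat) (f : 'rV[R]_n -> 'rV[R]_n)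
    (z : 'rV[R]_n) (e : R) :
  {for z, continuous f} -> 0 < e ->
  exists2 d : R, 0 < d & forall x, enorm (x - z) < d -> enorm (f x - f z) < e.
Proof.
move=> fz e0; apply: open_enorm_ball.
(* Dividing by [n.+1] rather than [n] keeps the divisor positive in dimension 0. *)
have n1 : 0 < n.+1%:R :> R by [].
have /cvgrPdist_lt/(_ (e / n.+1%:R) (divr_gt0 e0 n1)) := fz.
apply: filterS => x; rewrite distrC ltr_pdivlMr// mulrC; apply: le_lt_trans.
by rewrite (le_trans (enorm_le_normr _ _ _))// ler_wpM2r// ler_nat.
Qed.

(** Otherwise [A] is clopen, and so is its preimage under the line [l] from [a] to any [b]; as the
    reals are connected, [l] stays in [A] and reaches [b]. *)
Lemma boundary_neq0 (R : realType) (n : nat) (A : set 'rV[R]_n) :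
  A !=set0 -> A <> setT -> boundary A !=set0.
Proof.
move=> [a Aa] AT; apply: contrapT => /set0P/negP/negPn/eqP bA0.
have cA : closure A `<=` interior A.
  by move=> x clx; apply: contrapT => nx; have : boundary A x by []; rewrite bA0.
have oA : open A.
  by rewrite openE => x Ax; apply: cA; exact: subset_closure.
have clA : closed A by move=> x /cA/interior_subset.
apply: AT; apply/seteqP; split=> // b _.
pose l (t : R) := a + t *: (b - a).
have lc : continuous l.
  by move=> t; apply: cvgD; [exact: cvg_cst|apply: cvgZr_tmp; exact: cvg_id].
have cR : connected [set: R].
  by apply/connected_intervalP => x y _ _ z _.
have lAT : l @^-1` A = setT.
  apply: cR; first by exists 0; rewrite /= /l scale0r addr0.
  - by exists (l @^-1` A); [apply: open_comp => // t _; exact: lc|rewrite setTI].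
  - by exists (l @^-1` A); [apply: closed_comp => // t _; exact: lc|rewrite setTI].
have : (l @^-1` A) 1 by rewrite lAT.
by rewrite /= /l scale1r addrC subrK.
Qed.

(** * Estimates of the triangular ratio *)

Lemma triangular_ratio_ge (R : realType) (n : nat) (A : set 'rV[R]_n)
    (x y w : 'rV[R]_n) : boundary A w ->
  enorm (x - y) / (enorm (x - w) + enorm (w - y)) <= triangular_ratio A x y.
Proof.
move=> Aw; apply: ub_le_sup; last by exists w.
(* The triangle inequality bounds the quotients by 1; a vanishing denominator gives 0 by the
   convention [0^-1 = 0]. *)
exists 1 => _ [v _ <-].
have [->|v0] := eqVneq (enorm (x - v) + enorm (v - y)) 0; first by rewrite invr0 mulr0.
by rewrite ler_pdivrMr ?mul1r ?enormB_triangle// lt0r v0 addr_ge0 ?enorm_ge0.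
Qed.

Lemma triangular_ratio_le (R : realType) (n : nat) (A : set 'rV[R]_n)
    (x y : 'rV[R]_n) (m : R) : 0 < m -> boundary A !=set0 ->
  (forall w, boundary A w -> m <= enorm (x - w) + enorm (w - y)) ->
  triangular_ratio A x y <= enorm (x - y) / m.
Proof.
move=> m0 [v Av] mA; apply: ge_sup; first by eexists; exists v.
move=> _ [w /mA mw <-].
by rewrite ler_wpM2l ?enorm_ge0// lef_pV2// posrE (lt_le_trans m0).
Qed.

(* [d] is the distance from [z] to the boundary. *)
Lemma triangular_ratio_bounds (R : realType) (n : nat) (A : set 'rV[R]_n)
    (z : 'rV[R]_n) : nbhs z A -> A <> setT ->
  exists2 d : R, 0 < d & forall x, enorm (x - z) < 2 * d ->
    enorm (x - z) <= triangular_ratio A x z * (2 * d + enorm (x - z)) /\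
    triangular_ratio A x z * (2 * d - enorm (x - z)) <= enorm (x - z).
Proof.
move=> zA AT.
have bA : boundary A !=set0.
  by apply: boundary_neq0 => //; exists z; exact: nbhs_singleton.
pose D := [set enorm (z - w) | w in boundary A].
have D0 : D !=set0 by case: bA => w Aw; exists (enorm (z - w)), w.
have Dlb : has_lbound D by exists 0 => _ [w _ <-]; exact: enorm_ge0.
have dD w : boundary A w -> inf D <= enorm (z - w).
  by move=> Aw; apply: ge_inf => //; exists w.
(* A ball around [z] within the interior of [A] misses the boundary, so its radius is a lower bound
   for [inf D]. *)
have [e e0 eA] := open_enorm_ball _ _ _ _ (nbhs_interior zA).
have d0 : 0 < inf D.
  apply: (lt_le_trans e0); apply: lb_le_inf => // _ [w [_ Aw] <-].
  by rewrite leNgt enormBC; apply/negP => /eA.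
exists (inf D) => // x xz.
set s := triangular_ratio A x z; set r := enorm (x - z) in xz *.
have s0 : 0 <= s.
  case: bA => w Aw; apply: le_trans (triangular_ratio_ge _ _ _ x z w Aw).
  by rewrite divr_ge0 ?addr_ge0 ?enorm_ge0.
have s_ge w : boundary A w -> r <= s * (2 * enorm (z - w) + r).
  move=> Aw; have := triangular_ratio_ge _ _ _ x z w Aw; rewrite -/r -/s.
  rewrite (enormBC _ _ w) ler_pdivrMr; last first.
    by rewrite ltr_wpDl ?enorm_ge0// (lt_le_trans d0)// dD.
  move=> /le_trans; apply; rewrite ler_wpM2l//.
  by have := enormB_triangle _ _ z x w; rewrite -/r; lra.
split; last first.
  rewrite -ler_pdivlMr ?subr_gt0//; apply: triangular_ratio_le; rewrite ?subr_gt0//.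
  move=> w /dD; have := enormB_triangle _ _ x z w.
  by rewrite (enormBC _ _ z x) (enormBC _ _ w z) -/r; lra.
have [sE|s1] := eqVneq s 0.
  by case: bA => w /s_ge; rewrite sE !mul0r.
have sp : 0 < s by rewrite lt0r s1.
(* Solved for the distance, [s_ge] reads [(r / s - r) / 2 <= enorm (z - w)] for every boundary point
   [w], and so passes to the infimum. *)
suff : (r / s - r) / 2 <= inf D.
  by rewrite ler_pdivrMr// lerBlDr ler_pdivrMr//; nra.
apply: lb_le_inf => // _ [w /s_ge rw <-].
by rewrite ler_pdivrMr// lerBlDr ler_pdivrMr//; nra.
Qed.

(** * Openness of the image *)

Lemma exists_enorm (R : realType) (n : nat) (r : R) : (0 < n)%N -> 0 <= r ->
  exists v : 'rV[R]_n, enorm v = r.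
Proof.
case: n => // n _ r0; exists (\row_j (if j == ord0 then r else 0)).
rewrite /enorm (bigD1 ord0)//= big1 => [|i /negPf i0]; rewrite mxE.
  by rewrite eqxx addr0 sqrtr_sqr ger0_norm.
by rewrite i0 expr0n.
Qed.

(* If [f z] were not interior to the image [f @` G], it would belong to the
   boundary of the image, forcing [triangular_ratio (f @` G) (f x) (f z) = 1]
   for all [x <> z] in [G]; but [triangular_ratio G x z] tends to 0 as [x]
   tends to [z].  So no invariance of domain is needed. *)
Lemma triangular_bilipschitz_image_nbhs (R : realType) (n : nat)
    (G : set 'rV[R]_n)
    (f : 'rV[R]_n -> 'rV[R]_n) (L : R) (z : 'rV[R]_n) :
  (0 < n)%N -> nbhs z G -> G <> setT -> {in G &, injective f} -> 0 <= L ->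
  (forall x, G x ->
     triangular_ratio (f @` G) (f x) (f z) <= L * triangular_ratio G x z) ->
  nbhs (f z) (f @` G).
Proof.
move=> n0 zG GT fI L0 fL; apply: contrapT => fzG.
have Gz := nbhs_singleton zG.
have bfz : boundary (f @` G) (f z).
  by split=> //; apply: subset_closure; exists z.
have [d d0 sd] := triangular_ratio_bounds _ _ _ _ zG GT.
have [e e0 eG] := open_enorm_ball _ _ _ _ zG.
(* [r < e] keeps [x] in [G]. The ratio 1 in the image forces [1 <= L * s], which with
   [s * (2 * d - r) <= r] gives [2 * d <= r * (L + 1)]; the second bound on [r] excludes this. *)
pose r := Num.min (e / 2) (d / (L + 1)).
have r0 : 0 < r by rewrite lt_min !divr_gt0// ltr_wpDl.
have re : r < e by rewrite gt_min ltr_pdivrMr// mulr_natr mulr2n ltrDl e0.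
have rd : r * (L + 1) <= d by rewrite -ler_pdivlMr ?ltr_wpDl// ge_min lexx orbT.
have [v vr] := exists_enorm _ n r n0 (ltW r0).
pose x := z + v; have xz : enorm (x - z) = r by rewrite /x addrAC subrr add0r.
have Gx : G x by apply: eG; rewrite xz.
have [|_] := sd x; first by rewrite xz; nra.
rewrite xz => s_le.
have := le_trans (triangular_ratio_ge _ _ _ (f x) _ _ bfz) (fL x Gx).
have fxz : enorm (f x - f z) != 0.
  apply/eqP => /enorm_eq0/eqP; rewrite subr_eq0 => /eqP/fI xzE.
  by move: r0; rewrite -xz xzE ?inE// subrr enorm0 ltxx.
rewrite subrr enorm0 addr0 divff// => s_ge.
set s := triangular_ratio G x z in s_le s_ge.
suff : d < r * (L + 1) by rewrite ltNge rd.
have dr : 0 <= 2 * d - r by nra.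
have : L * s * (2 * d - r) <= L * r by rewrite -mulrA ler_wpM2l.
have := ler_wpM2r dr s_ge.
by lra.
Qed.

(** * The linear dilatation *)

Lemma limf_esup_at_right_le (R : realType) (h : R -> \bar R) (a e : R)
    (M : \bar R) : 0 < e ->
  (forall r, a < r -> r < a + e -> (h r <= M)%E) ->
  (limf_esup h (a^'+) <= M)%E.
Proof.
move=> e0 hM; pose V := [set r | a < r < a + e].
(* The upper limit is an infimum of suprema over neighbourhoods, hence at most the supremum over
   [V]. *)
apply: (@le_trans _ _ (ereal_sup [set h x | x in V])).
  apply: ereal_inf_lbound; exists V => //.
  near=> r; rewrite /V /=; apply/andP; split; near: r.
    exact: nbhs_right_gt.
  by apply: nbhs_right_lt; rewrite ltrDl.
by apply: ge_ereal_sup => _ [r /andP[? ?] <-]; exact: hM.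
Unshelve. all: by end_near. Qed.

(* With [r] the radius in the source, [p], [q] the distances of the image points
   to [f z], and [d], [d'] the distances of [z], [f z] to the boundaries. *)
Lemma distortion_ratio (R : realFieldType) (L d d' r p q sp sq tp tq eta : R) :
  0 <= L -> 0 < d -> 0 < d' -> 0 < r -> 0 <= p -> 0 < q -> 0 < eta ->
  eta <= 2^-1 -> r <= eta * (2 * d) -> p <= eta * (2 * d') ->
  q <= eta * (2 * d') ->
  sp * (2 * d - r) <= r -> r <= sq * (2 * d + r) ->
  p <= tp * (2 * d' + p) -> tq * (2 * d' - q) <= q ->
  tp <= L * sp -> sq <= L * tq ->
  p / q <= L ^+ 2 * (1 + 16 * eta).
Proof.
move=> L0 d0 d'0 r0 p0 q0 eta0 eta2 rd pd qd Hsp Hsq Htp Htq Lp Lq.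
have h1 : 0 < 2 * d - r by nra.
have h2 : 0 < 2 * d' - q by nra.
have h1' : (1 - eta) * (2 * d) <= 2 * d - r by nra.
have h2' : (1 - eta) * (2 * d') <= 2 * d' - q by nra.
have h3 : 2 * d + r <= (1 + eta) * (2 * d) by nra.
have h4 : 2 * d' + p <= (1 + eta) * (2 * d') by nra.
have spE : sp <= r / (2 * d - r) by rewrite ler_pdivlMr.
have tqE : tq <= q / (2 * d' - q) by rewrite ler_pdivlMr.
have e1 : 0 < 1 - eta by lra.
have dd0 : 0 < 2 * d by lra.
have dd'0 : 0 < 2 * d' by lra.
have spE' : sp <= r / ((1 - eta) * (2 * d)).
  by apply: (le_trans spE); rewrite ler_pM2l// lef_pV2// posrE mulr_gt0.
have tqE' : tq <= q / ((1 - eta) * (2 * d')).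
  by apply: (le_trans tqE); rewrite ler_pM2l// lef_pV2// posrE mulr_gt0.
(* [k] is the cost of replacing [2 * d - r] and [2 * d' + p], or [2 * d' - q] and [2 * d + r], by
   [2 * d] and [2 * d']. Then [p / (2 * d') <= L * k * (r / (2 * d))] and
   [r / (2 * d) <= L * k * (q / (2 * d'))] chain together. *)
pose k := (1 + eta) / (1 - eta).
have k0 : 0 < k by rewrite divr_gt0//; lra.
have a1 : p <= L * (r / (2 * d)) * (k * (2 * d')).
  apply: (le_trans Htp).
  apply: (@le_trans _ _ (L * (r / ((1 - eta) * (2 * d))) * (2 * d' + p))).
    rewrite ler_wpM2r//; first by nra.
    by apply: (le_trans Lp); rewrite ler_wpM2l.
  have -> : L * (r / (2 * d)) * (k * (2 * d')) =
     L * (r / ((1 - eta) * (2 * d))) * ((1 + eta) * (2 * d')).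
    by rewrite /k; field; rewrite !gt_eqF.
  by rewrite ler_wpM2l// mulr_ge0// divr_ge0 ?mulr_ge0// ltW.
have a2 : r <= L * (q / (2 * d')) * (k * (2 * d)).
  apply: (le_trans Hsq).
  apply: (@le_trans _ _ (L * (q / ((1 - eta) * (2 * d'))) * (2 * d + r))).
    rewrite ler_wpM2r//; first by nra.
    by apply: (le_trans Lq); rewrite ler_wpM2l.
  have -> : L * (q / (2 * d')) * (k * (2 * d)) =
     L * (q / ((1 - eta) * (2 * d'))) * ((1 + eta) * (2 * d)).
    by rewrite /k; field; rewrite !gt_eqF.
  by rewrite ler_wpM2l// mulr_ge0// divr_ge0 ?mulr_ge0// ltW.
rewrite ler_pdivrMr//.
apply: (@le_trans _ _ (L ^+ 2 * k ^+ 2 * q)).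
  apply: (le_trans a1).
  have -> : L ^+ 2 * k ^+ 2 * q =
     L * ((L * (q / (2 * d')) * (k * (2 * d))) / (2 * d)) * (k * (2 * d')).
    by field; rewrite !gt_eqF.
  rewrite ler_wpM2r//; first exact/ltW/mulr_gt0.
  by rewrite ler_wpM2l// ler_wpM2r// invr_ge0 ltW.
rewrite ler_wpM2r//; first exact: ltW.
rewrite ler_wpM2l ?sqr_ge0//.
(* There remains [k ^+ 2 <= 1 + 16 * eta]; the factorization below vanishes at [eta = 1/2], so 16 is
   the least constant valid up to there. *)
rewrite /k expr_div_n ler_pdivrMr ?exprn_gt0// -subr_ge0.
have -> : (1 + 16 * eta) * (1 - eta) ^+ 2 - (1 + eta) ^+ 2 =
  4 * eta * (1 - 2 * eta) * (3 - 2 * eta) by ring.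
by rewrite !mulr_ge0//; lra.
Qed.

Theorem theorem4p4 (R : realType) (n : nat) (hn : (2 <= n)%N)
  (G : set 'rV[R]_n) (hG : domain G) (hGT : G <> setT)
  (f : 'rV[R]_n -> 'rV[R]_n) (hf : homeo_on G f) (hfGT : f @` G <> setT)
  (hsp : sense_preserving G f)
  (L : R) (hL : 1 <= L)
  (hbil : forall x y : 'rV[R]_n, G x -> G y ->
     triangular_ratio G x y / L <= triangular_ratio (f @` G) (f x) (f y) /\
     triangular_ratio (f @` G) (f x) (f y) <= L * triangular_ratio G x y) :
  quasiconformal G f /\
  (forall z : 'rV[R]_n, G z -> (linear_dilatation G f z <= (L ^+ 2)%:E)%E).
Proof.
have [oG cG G0] := hG; have [fc [g _ gf]] := hf.
have L0 : 0 < L by lra.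
have fI : {in G &, injective f}.
  by move=> x y /set_mem Gx /set_mem Gy fxy; rewrite -(gf x)// -(gf y)// fxy.
have nG z : G z -> nbhs z G by move=> Gz; exact: open_nbhs_nbhs.
(* This provides a positive boundary distance at [f z] and, at the end, openness of the image. *)
have nfG z : G z -> nbhs (f z) (f @` G).
  move=> Gz; apply: (@triangular_bilipschitz_image_nbhs R n G f L z) => //.
  - exact: ltnW.
  - exact: nG.
  - exact: ltW.
  - by move=> x Gx; have [] := hbil x z Gx Gz.
have dil z : G z -> (linear_dilatation G f z <= (L ^+ 2)%:E)%E.
  move=> Gz; apply/lee_addgt0Pr => eps eps0.
  have [d d0 sd] := triangular_ratio_bounds _ _ _ _ (nG z Gz) hGT.
  have [d' d'0 sd'] := triangular_ratio_bounds _ _ _ _ (nfG z Gz) hfGT.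
  (* The two summands of the denominator ensure [16 * L ^+ 2 * eta <= eps] and [eta <= 1/2]
     respectively. *)
  pose eta := eps / (16 * L ^+ 2 + 2 * eps).
  have den0 : 0 < 16 * L ^+ 2 + 2 * eps by nra.
  have eta0 : 0 < eta by rewrite divr_gt0.
  have etaE : eta * (16 * L ^+ 2 + 2 * eps) = eps by rewrite divfK// gt_eqF.
  have eta2 : eta <= 2^-1 by rewrite ler_pdivrMr//; nra.
  have etaL : L ^+ 2 * (1 + 16 * eta) <= L ^+ 2 + eps by nra.
  have fcz : {for z, continuous f}.
    by move: fc; rewrite continuous_open_subspace// => /(_ z); apply; rewrite inE.
  have etad'0 : 0 < eta * (2 * d') by do 2!apply: mulr_gt0 => //.
  have [e e0 fe] := continuous_enorm _ _ _ _ _ fcz etad'0.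
  (* Radii below [e1] are small relative to [d], and by continuity the image displacements are small
     relative to [d']. *)
  pose e1 := Num.min e (eta * (2 * d)).
  have e10 : 0 < e1 by rewrite lt_min e0/= mulr_gt0// mulr_gt0.
  apply: (@limf_esup_at_right_le _ _ _ e1) => // r r0.
  rewrite add0r lt_min => /andP[re rd].
  apply: ge_ereal_sup => _ [x [y [Gx Gy xr yr ->]]].
  rewrite -EFinD lee_fin; apply: le_trans etaL.
  have /ltW fxe : enorm (f x - f z) < eta * (2 * d') by apply: fe; rewrite xr.
  have /ltW fye : enorm (f y - f z) < eta * (2 * d') by apply: fe; rewrite yr.
  have q0 : 0 < enorm (f y - f z).
    rewrite lt0r enorm_ge0 andbT; apply/eqP => /enorm_eq0/eqP.
    rewrite subr_eq0 => /eqP/fI yzE.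
    by move: r0; rewrite -yr yzE ?inE// subrr enorm0 ltxx.
  (* For [x], in the numerator, the ratio is bounded above in [G] and below in the image; for [y]
     the reverse. Each point costs one factor [L]. *)
  have [|_] := sd x; [by rewrite xr; nra|rewrite xr => Hsp].
  have [|Hsq _] := sd y; [by rewrite yr; nra|rewrite yr in Hsq].
  have [|Htp _] := sd' (f x); first by nra.
  have [|_ Htq] := sd' (f y); first by nra.
  have [_ Lp] := hbil x z Gx Gz.
  have [+ _] := hbil y z Gy Gz; rewrite ler_pdivrMr// mulrC => Lq.
  exact: (@distortion_ratio _ _ _ _ _ _ _ _ _ _ _ _ (ltW L0) d0 d'0 r0
    (enorm_ge0 _ _ _) q0 eta0 eta2 (ltW rd) fxe fye Hsp Hsq Htp Htq Lp Lq).
split=> //; split=> //; last by exists (L ^+ 2).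
split.
- by rewrite openE => _ [z Gz <-]; exact: nfG.
- exact: connected_continuous_connected.
- by case: G0 => z Gz; exists (f z), z.
Qed.
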